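(* Let $n\ge1$. The number of ad-nilpotent ideals in $\mathcal I^n$ with class of nilpotence at most $2$ is the Fibonacci number $F_{2n}$, where $F_0=F_1=1$ and $F_{m}=F_{m-1}+F_{m-2}$ for $m\ge2$. The number of ad-nilpotent ideals in $\mathcal I^n$ with class of nilpotence at most $3$ is $(3^n+1)/2$.
   Context: Let $\mathfrak g=sl(n+1,\mathbb C)$ with a fixed Cartan subalgebra $\mathfrak h$, positive roots $\Delta^+$, root spaces $\mathfrak g_\alpha$, and Borel subalgebra $\mathfrak b=\mathfrak h\oplus\bigoplus_{\alpha\in\Delta^+}\mathfrak g_\alpha$. $\mathcal I^n$ is the set of ad-nilpotent ideals of $\mathfrak b$, i.e. ideals of $\mathfrak b$ consisting of ad-nilpotent elements. For $\mathfrak i\in\mathcal I^n$ put $\mathfrak i^1=\mathfrak i$, $\mathfrak i^{m}=[\mathfrak i^{m-1},\mathfrak i]$. The class of nilpotence of $\mathfrak i$ is the smallest $m\ge0$ with $\mathfrak i^{m+1}=0$ (so the zero ideal has class $0$, and Abelian ideals are exactly those of class at most $1$). *)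

(* Defs.v *)
From HB Require Import structures.
From mathcomp Require Import all_boot all_order all_algebra all_field.
From mathcomp Require Import boolp classical_sets cardinality reals complex.

Set Implicit Arguments.
Unset Strict Implicit.
Unset Printing Implicit Defensive.

Import GRing.Theory.
Local Open Scope ring_scope.

(* Lie algebras are represented as subspaces of an associative algebra A,
   with the commutator [x, y] = x * y - y * x as bracket. *)
Section LieAlgebra.
Variables (K : fieldType) (A : falgType K).
Implicit Types (x y : A) (U V L g h i : {vspace A}).

Definition ad x : 'End(A) := amull x - amulr x.

Lemma adE x y : ad x y = x * y - y * x.
Proof. by rewrite /ad add_lfunE opp_lfunE !lfunE. Qed.

(* The span of all brackets [u, v] with u in U and v in V; by bilinearity,
   brackets of basis vectors suffice (compare prodv, and liebrvP below). *)
Definition liebrv U V : {vspace A} :=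
  <<[seq ad u v | u <- vbasis U, v <- vbasis V]>>%VS.

Lemma liebrvP U V L :
  reflect (forall u v, u \in U -> v \in V -> u * v - v * u \in L)
          (liebrv U V <= L)%VS.
Proof.
apply: (iffP span_subvP) => [sL u v uU vV | sL w /allpairsP[[u v] /= [uU vV ->]]].
  rewrite -adE (coord_vbasis vV) linear_sum memv_suml // => k _.
  rewrite linearZ memvZ //= adE -opprB memvN -adE (coord_vbasis uU).
  rewrite linear_sum memv_suml // => j _.
  rewrite linearZ memvZ //= adE -opprB memvN -adE.
  apply: sL; apply/allpairsP; exists ((vbasis U)`_j, (vbasis V)`_k).
  by rewrite /= !mem_nth ?size_tuple.
by rewrite adE; apply: sL; apply: vbasis_mem.
Qed.

Definition lie_ideal L i := ((i <= L) && (liebrv L i <= i))%VS.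

Definition ad_nilpotent L x :=
  exists k : nat, forall y, y \in L -> iter k (ad x) y = 0.

Definition ad_nilpotent_ideal L i :=
  lie_ideal L i /\ forall x, x \in i -> ad_nilpotent L x.

(* lpow i m is i^m = [i^(m-1), i] for m >= 1. *)
Definition lpow i (m : nat) : {vspace A} := iter m.-1 (fun U => liebrv U i) i.

Definition nilpotence_class i (m : nat) :=
  lpow i m.+1 = 0%VS /\ forall k : nat, lpow i k.+1 = 0%VS -> (m <= k)%N.

Definition class_at_most i (k : nat) :=
  exists2 m : nat, nilpotence_class i m & (m <= k)%N.

Definition ad_diagonalizable g x :=
  exists2 s : seq A, basis_of g s
    & forall y, y \in s -> exists a : K, ad x y = a *: y.

(* Cartan subalgebras of a complex semisimple Lie algebra g: maximal
   (i.e. self-centralizing) Abelian subalgebras of ad-diagonalizable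
   elements. *)
Definition cartan_subalgebra g h :=
  [/\ (h <= g)%VS,
      forall x y, x \in h -> y \in h -> ad x y = 0,
      forall y, y \in g -> (forall x, x \in h -> ad x y = 0) -> y \in h
    & forall x, x \in h -> ad_diagonalizable g x].

Section Roots.
Variables g h : {vspace A}.

Definition dual := 'Hom(subvs_of h, K^o).
Implicit Types (alpha beta : dual) (Dp : seq dual).

Definition root_space alpha : {vspace A} :=
  (g :&: \bigcap_(H <- vbasis {:subvs_of h})
           passmx.leigenspace (ad (vsval H)) (alpha H))%VS.

Lemma root_spaceP alpha y :
  reflect (y \in g /\ forall H : subvs_of h, ad (vsval H) y = alpha H *: y)
          (y \in root_space alpha).
Proof.
have evP (H : subvs_of h) : (y \in passmx.leigenspace (ad (vsval H)) (alpha H))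
    = (ad (vsval H) y == alpha H *: y).
  by rewrite memv_ker add_lfunE opp_lfunE scale_lfunE id_lfunE subr_eq0.
have capP (s : seq (subvs_of h)) :
    reflect (forall H, H \in s -> ad (vsval H) y = alpha H *: y)
    (y \in \bigcap_(H <- s) passmx.leigenspace (ad (vsval H)) (alpha H))%VS.
  elim: s => [|H s IHs]; first by rewrite big_nil memvf; constructor.
  rewrite big_cons memv_cap evP; apply: (iffP andP).
    by case=> /eqP yH /IHs ys H'; rewrite inE => /predU1P[->|/ys].
  move=> ys; split; first by apply/eqP/ys/mem_head.
  by apply/IHs => H' sH'; apply: ys; rewrite inE sH' orbT.
rewrite memv_cap; apply: (iffP andP) => -[gy ys]; split=> //; last first.
  by apply/capP=> H _; apply: ys.
move/capP: ys => ys H; rewrite (coord_vbasis (memvf H)) !linear_sum /=.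
rewrite adE mulr_suml mulr_sumr -sumrB scaler_suml; apply: eq_bigr => j _.
rewrite !linearZ /= -scalerAl -scalerAr -scalerBr -adE ys ?scalerA //.
by rewrite mem_nth ?size_tuple.
Qed.

Definition is_root alpha := (alpha != 0) && (root_space alpha != 0%VS).

(* Dp enumerates a choice of positive roots: exactly one of alpha and -alpha
   is positive for each root alpha, and a root that is the sum of two positive
   roots is positive. *)
Definition positive_roots Dp :=
  [/\ forall alpha, alpha \in Dp -> is_root alpha,
      forall alpha, is_root alpha -> (alpha \in Dp) = (- alpha \notin Dp)
    & forall alpha beta, alpha \in Dp -> beta \in Dp ->
        is_root (alpha + beta) -> alpha + beta \in Dp].

Definition borel Dp : {vspace A} :=
  (h + \sum_(alpha <- Dp) root_space alpha)%VS.

End Roots.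
End LieAlgebra.

Definition sl (K : fieldType) (n : nat) : {vspace 'M[K]_n.+1} :=
  lker (linfun (mxtrace : 'M[K]_n.+1 -> K^o)).

Lemma slP (K : fieldType) (n : nat) (x : 'M[K]_n.+1) :
  (x \in sl K n) = (\tr x == 0).
Proof. by rewrite memv_ker lfunE. Qed.

Fixpoint fib (m : nat) : nat :=
  match m with
  | 0 | 1 => 1
  | (m'.+1 as m1).+1 => (fib m1 + fib m')%N
  end.

(* Main.v *)
Require Import Defs.
From HB Require Import structures.
From mathcomp Require Import all_boot all_order all_fingroup all_algebra all_field.
From mathcomp Require Import zify ring.
From mathcomp Require Import boolp classical_sets cardinality reals complex.

(* Simultaneously diagonalizing the Cartan subalgebra and ordering the basis by
   the positive roots turns the Borel subalgebra into the traceless upper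
   triangular matrices. An ad-nilpotent ideal is then spanned by the matrix
   units E_ij with j >= f i, for a unique nondecreasing f on {0, ..., n} with
   i < f i <= n + 1 (set f j = n + 1 for j > n), and its m-th power
   corresponds in the same way to the m-th iterate of f. So the ideals of
   class at most k are counted by the f with f^(k+1) 0 = n + 1.

   Such an f is the breadth-first code of a plane forest with n + 1 nodes and at
   most k + 1 levels: f i is the number of nodes discovered before the children
   of node i are listed. Hence the generating functions G_k for forests with
   fewer than k levels satisfy G_(k+1) = 1 / (1 - X G_k), which gives
   G_4 = (1 - 2X) / (1 - 3X + X^2) and G_5 = (1 - 3X + X^2) / (1 - 4X + 3X^2). *)

Set Implicit Arguments.
Unset Strict Implicit.
Unset Printing Implicit Defensive.

Import Order.TTheory GRing.Theory Num.Theory.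
Local Open Scope ring_scope.

(** * Breadth-first codes of plane forests *)

Section Frontier.
Variable N : nat.
Implicit Types (f : {ffun 'I_N -> 'I_N.+1}) (h : nat -> nat).

Definition ext f (j : nat) : nat := if insub j is Some i then f i else N.

Definition frontier f :=
  [forall i : 'I_N, i < f i]%N
  && [forall i : 'I_N, forall j : 'I_N, (i <= j)%N ==> (f i <= f j)%N].

Lemma ext_ord f (i : 'I_N) : ext f i = f i.
Proof. by rewrite /ext valK. Qed.

Lemma ext_lt f j (jN : (j < N)%N) : ext f j = f (Ordinal jN).
Proof. exact: (ext_ord f (Ordinal jN)). Qed.

Lemma ext_ge f j : (N <= j)%N -> ext f j = N.
Proof. by move=> Nj; rewrite /ext insubF // ltnNge Nj. Qed.

Lemma ext_le f j : (ext f j <= N)%N.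
Proof. by rewrite /ext; case: insub => // i; rewrite -ltnS. Qed.

Lemma frontierP f :
  reflect ((forall j, (j < N)%N -> (j < ext f j)%N)
           /\ {homo ext f : j l / (j <= l)%N}) (frontier f).
Proof.
apply: (iffP andP) => [[/forallP f1 /forallP f2]|[f1 f2]]; split.
- by move=> j jN; rewrite ext_lt; apply: (f1 (Ordinal jN)).
- move=> j l jl; case: (ltnP l N) => lN; last by rewrite [ext f l]ext_ge ?ext_le.
  have jN := leq_ltn_trans jl lN.
  rewrite !ext_lt; by have /forallP/(_ (Ordinal lN))/implyP/(_ jl) := f2 (Ordinal jN).
- by apply/forallP=> i; rewrite -ext_ord f1.
- by apply/forallP=> i; apply/forallP=> j; apply/implyP=> ij; rewrite -!ext_ord f2.
Qed.

Lemma iter_ext_ge f k : iter k (ext f) N = N.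
Proof. by elim: k => //= k ->; apply: ext_ge. Qed.

(* Agrees up to degree N with the power series of the header, where the sum
   is the full geometric series. *)
Fixpoint forest_gf (k : nat) : {poly int} :=
  if k is k'.+1 then \sum_(j < N.+1) ('X * forest_gf k') ^+ j else 0.
Local Notation G := forest_gf.

(** Telescoping the truncated geometric sum leaves one error term, divisible by ['X^(N.+1)] and
    hence invisible up to degree [N]. *)
Lemma forest_gfS k : G k.+1 = 1 + 'X * G k * G k.+1 - ('X * G k) ^+ N.+1.
Proof.
rewrite [G k.+1]/=; set x := 'X * _; have := subrX1 x N.+1.
set s := \sum_(i < _) _ => E; apply/eqP; rewrite -subr_eq0; apply/eqP.
transitivity (x ^+ N.+1 - 1 - (x - 1) * s); first by ring.
by rewrite E subrr.
Qed.

Lemma coefXM_small (x q : {poly int}) m : (m <= N)%N -> (('X * x) ^+ N.+1 * q)`_m = 0.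
Proof. by move=> mN; rewrite exprMn -mulrA coefXnM ltnS mN. Qed.

Lemma coef0_forest_gf k : (G k.+1)`_0 = 1.
Proof.
rewrite forest_gfS coefB coefD coef1 -mulrA coefXM -[(_ * _) ^+ _]mulr1.
by rewrite coefXM_small ?addr0 ?subr0.
Qed.

(** This is [forest_gfS] times [G k.+1 ^+ r * q]. The two terms mirror the choice at the current
    node: no further child, or one more, which costs a factor ['X] and carries a subtree counted by
    [G k]. *)
Lemma coef_forest_gfS k r q m : (m <= N)%N ->
  (G k.+1 ^+ r.+1 * q)`_m
    = (G k.+1 ^+ r * q)`_m + ('X * (G k.+1 ^+ r.+1 * (G k * q)))`_m.
Proof.
move=> mN; suff -> : G k.+1 ^+ r.+1 * q = G k.+1 ^+ r * q
    + 'X * (G k.+1 ^+ r.+1 * (G k * q)) - ('X * G k) ^+ N.+1 * (G k.+1 ^+ r * q).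
  by rewrite coefB coefD coefXM_small // subr0.
by rewrite exprS {1}forest_gfS; ring.
Qed.

Definition completions h i e p k :=
  [set f | frontier f & [forall j : 'I_N, if (j < i)%N then f j == h j :> nat
                                          else (p <= f j)%N]
                        && (iter k (ext f) e == N)].

Lemma completionsP h i e p k f :
  reflect [/\ frontier f, forall j, (j < i)%N -> (j < N)%N -> ext f j = h j,
            forall j, (i <= j)%N -> (j < N)%N -> (p <= ext f j)%N
            & iter k (ext f) e = N]
          (f \in completions h i e p k).
Proof.
rewrite inE; apply: (iffP and3P) => [[fF /forallP fh /eqP fk]|[fF f1 f2 /eqP fk]].
  split=> // j ji jN; have := fh (Ordinal jN); rewrite /= ?ji ?ltnNge ?ji /=.
    by move/eqP; rewrite -ext_ord.
  by rewrite -ext_ord.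
split=> //; apply/forallP=> j; case: ltnP => ji; rewrite -ext_ord.
  by rewrite f1.
exact: f2.
Qed.

Lemma ext_inord g j : (g j <= N)%N -> (j < N)%N ->
  ext [ffun l : 'I_N => inord (g l)] j = g j.
Proof.
by move=> gN jN; rewrite ext_lt ffunE inordK.
Qed.

Lemma ext_inj f1 f2 : (forall j, (j < N)%N -> ext f1 j = ext f2 j) -> f1 = f2.
Proof. by move=> e12; apply/ffunP=> i; apply/val_inj; rewrite /= -!ext_ord e12. Qed.

(* h records the first i steps of the breadth-first search, p nodes have been
   discovered so far and the current level ends at e. Each of the e - i + 1 nodes
   of this level still to be processed carries a subtree counted by G (k + 1),
   each of the p - e nodes found on the next level one counted by G k. *)
Lemma card_completions h i e p k :
  (i <= e <= p)%N -> (p <= N)%N ->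
  (forall j, (j < i)%N -> (j < h j <= p)%N) ->
  (forall j l, (j <= l < i)%N -> (h j <= h l)%N) ->
  #|completions h i e p k|%:Z = (G k.+1 ^+ (e - i).+1 * G k ^+ (p - e))`_(N - p).
Proof.
(* Each step of the search increases [i] or [p], so this measure drops. *)
have [m] := ubnP ((N - i) + (N - p)); elim: m => // m IHm in h i e p k * => ltm.
case/andP=> ie ep pN hj hh.
(* Once every index is processed, the only completion is the code recorded in [h]. *)
have [iN|] := leqP N i.
  have [-> -> ->] : [/\ i = N, e = N & p = N] by split; lia.
  rewrite !subnn expr1 expr0 mulr1 coef0_forest_gf.
  have eh j : (j < N)%N -> ext [ffun l : 'I_N => inord (h l)] j = h j.
    by move=> jN; apply: ext_inord => //; have := hj j; lia.
  rewrite (_ : completions _ _ _ _ _ = [set [ffun l : 'I_N => inord (h l)]]) ?cards1 //.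
  apply/finset.setP=> f; rewrite inE; apply/completionsP/eqP => [[_ fh _ _]|->].
    by apply: ext_inj => j jN; rewrite eh // fh.
  split; rewrite ?iter_ext_ge //; last by move=> j; lia.
    apply/frontierP; split=> [j jN|j l jl]; first by rewrite eh //; have := hj j; lia.
    have [lN|lN] := leqP N l; first by rewrite [X in (_ <= X)%N]ext_ge ?ext_le.
    by rewrite !eh //; [apply: hh; lia|lia].
  by move=> j _ jN; rewrite eh.
move=> iN.
(* In [A] the index [i] is closed without a further child, in [B] at least one more follows. They
   match the two terms of [coef_forest_gfS]. *)
pose A := [set f in completions h i e p k | (ext f i == p)%N].
pose B := [set f in completions h i e p k | (ext f i != p)%N].
have -> : #|completions h i e p k| = (#|A| + #|B|)%N.
  rewrite -(cardsID [set f | ext f i == p]); congr (_ + _)%N.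
    by apply: eq_card => f; rewrite !inE.
  by apply: eq_card => f; rewrite !inE andbC.
rewrite PoszD coef_forest_gfS ?leq_subr //; congr (_ + _).
  pose h' j := if j == i then p else h j.
  have h'j j : (j < i)%N -> h' j = h j by rewrite /h'; case: eqP => //; lia.
  have h'i : h' i = p by rewrite /h' eqxx.
  (* [e'] and [k'] stay free because closing [i] may also end the level: if [i = e], the next level
     ends at [p] and one iteration of [ext f] is used up. *)
  have AE e' k' : (forall f, f \in A -> iter k' (ext f) e' = iter k (ext f) e) ->
       (forall f, f \in completions h' i.+1 e' p k' ->
                  iter k' (ext f) e' = iter k (ext f) e) ->
       A = completions h' i.+1 e' p k'.
    move=> Ak Ck; apply/finset.setP=> f; apply/idP/idP => fA.
      have := fA; rewrite inE => /andP[/completionsP[fF fh fp fk] /eqP fi].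
      apply/completionsP; split=> //; last by rewrite Ak.
        move=> j; rewrite ltnS leq_eqVlt => /predU1P[->|ji]; rewrite ?h'i ?h'j //.
        by apply: fh.
      by move=> j ij jN; apply: fp => //; lia.
    have := fA => /completionsP[fF fh fp fk]; have fi := fh i (leqnn _) iN.
    rewrite inE fi h'i eqxx andbT; apply/completionsP; split=> //; last by rewrite -Ck.
      by move=> j ji jN; rewrite fh ?h'j //; lia.
    move=> j; rewrite leq_eqVlt => /predU1P[<-|ij] jN; first by rewrite fi h'i.
    exact: fp.
  have h'P : (i < p)%N -> forall j, (j < i.+1)%N -> (j < h' j <= p)%N.
    move=> ip j; rewrite ltnS leq_eqVlt => /predU1P[->|ji]; rewrite ?h'i ?h'j //.
      by rewrite ip leqnn.
    exact: hj.
  have h'M : forall j l, (j <= l < i.+1)%N -> (h' j <= h' l)%N.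
    move=> j l; rewrite ltnS [(l <= i)%N]leq_eqVlt => /andP[jl /predU1P[li|li]].
      rewrite li h'i; move: jl; rewrite li leq_eqVlt => /predU1P[->|ji]; rewrite ?h'i ?h'j //.
      by have := hj j ji; lia.
    by rewrite !h'j; [apply: hh; lia|lia..].
  have [ltie|] := ltnP i e.
    rewrite (AE e k) //; rewrite IHm //; try lia.
      by rewrite (_ : (e - i.+1).+1 = e - i)%N //; lia.
    by apply: h'P; lia.
  move=> ei; have {ei ie} ei : e = i by lia.
  rewrite ei subnn expr0 mul1r.
  (* If [p = i], the search runs out of nodes too early: [i < f i] excludes every code, and the
     constant 1 has no coefficient in the positive degree [N - i]. *)
  have [ltip|pi] := ltnP i p; last first.
    have -> : p = i by lia.
    rewrite subnn expr0 coef1 (_ : (N - i == 0)%N = false); last by lia.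
    apply/eqP; rewrite eqz_nat cards_eq0 -finset.subset0; apply/fintype.subsetP=> f.
    rewrite inE => /andP[/completionsP[/frontierP[f1 _] _ _ _] /eqP fi].
    by have := f1 i iN; lia.
  (* For [k = 0] no further level is allowed although it has nodes; on the other side a positive
     power of [G 0 = 0] appears. *)
  have [k0|k_gt0] := posnP k.
    rewrite k0 expr0n (_ : (p - i == 0)%N = false) ?coef0; last by lia.
    apply/eqP; rewrite eqz_nat cards_eq0 -finset.subset0; apply/fintype.subsetP=> f.
    by rewrite inE k0 => /andP[/completionsP[_ _ _ /= fk] _]; lia.
  have kE := prednK k_gt0; rewrite (AE p k.-1); last 2 first.
  - by move=> f; rewrite inE -[in RHS]kE iterSr ei => /andP[_ /eqP ->].
  - by move=> f /completionsP[_ fh _ _]; rewrite -[in RHS]kE iterSr ei fh ?h'i.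
  rewrite IHm ?kE ?subnn ?mulr1 //; try lia.
    by rewrite -subSn // subSS.
  exact: h'P.
rewrite coefXM.
(* With all [N] nodes found there is no further child, and the factor ['X] kills the constant
   coefficient. *)
have [Np|pN'] := leqP N p.
  rewrite (_ : (N - p == 0)%N) /=; last by lia.
  apply/eqP; rewrite eqz_nat cards_eq0 -finset.subset0; apply/fintype.subsetP=> f.
  rewrite inE => /andP[/completionsP[_ _ fp _]].
  by have := ext_le f i; have := fp i (leqnn _) iN; lia.
rewrite (_ : (N - p == 0)%N = false) /=; last by lia.
rewrite (_ : B = completions h i e p.+1 k).
  rewrite IHm //; try lia.
    by rewrite subSn // -subnS -exprS.
  by move=> j /hj; lia.
apply/finset.setP=> f; rewrite inE; apply/andP/completionsP.
  case=> /completionsP[fF fh fp fk] fi; split=> // j ij jN.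
  have /frontierP[_ f2] := fF; apply: leq_trans (f2 _ _ ij).
  by rewrite ltn_neqAle eq_sym fi fp.
case=> fF fh fp fk; split; last by have := fp i (leqnn _) iN; lia.
by apply/completionsP; split=> // j ij jN; apply: ltnW; apply: fp.
Qed.

(** The search starts at a virtual root above the forest: one node to process and no value recorded,
    so that [id] is a dummy. *)
Lemma card_frontier k :
  #|[set f | frontier f & iter k (ext f) 0 == N]|%:Z = (G k.+1)`_N.
Proof.
transitivity (#|completions id 0 0 0 k|%:Z).
  congr Posz; apply: eq_card => f; rewrite inE; apply/andP/completionsP.
    by case=> fF /eqP fk; split.
  by case=> fF _ _ ->.
by rewrite card_completions ?subn0 ?expr1 ?mulr1 // => j l; rewrite ltn0 andbF.
Qed.

(* Up to degree N, forest_gf is a convergent of the continued fraction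
   1 / (1 - X / (1 - X / ...)). *)
Lemma forest_gf_convergent k (D M : {poly int}) :
  (exists r, G k * D = M + 'X^(N.+1) * r) ->
  exists r, G k.+1 * (D - 'X * M) = D + 'X^(N.+1) * r.
Proof.
case=> r Er; exists (G k.+1 * 'X * r - G k ^+ N.+1 * D).
have -> : 'X * M = 'X * (G k * D) - 'X * ('X^(N.+1) * r) by rewrite Er mulrDr addrK.
have : G k.+1 - 'X * G k * G k.+1 = 1 - ('X * G k) ^+ N.+1.
  by rewrite {1}forest_gfS; ring.
move/(congr1 (fun x => x * D)); rewrite exprMn => E.
transitivity ((G k.+1 - 'X * G k * G k.+1) * D + 'X^(N.+1) * (G k.+1 * 'X * r)).
  by ring.
by rewrite E; ring.
Qed.

Lemma coef_forest_gf (k : nat) (D M : {poly int}) :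
  (exists r, G k * D = M + 'X^(N.+1) * r) ->
  forall m, (m <= N)%N -> (G k * D)`_m = M`_m.
Proof.
by case=> r -> m mN; rewrite coefD coefXnM ltnS mN addr0.
Qed.

Lemma forest_gf1 : exists r, G 1 * 1 = 1 + 'X^(N.+1) * r.
Proof. by exists 0; rewrite forest_gfS !mulr0 mul0r expr0n /= !(mulr0, addr0, subr0) mulr1. Qed.

Lemma coef_quadratic (p : {poly int}) (b c : int) m :
  (p * (1 - b%:P * 'X + c%:P * 'X^2))`_m.+2 = p`_m.+2 - b * p`_m.+1 + c * p`_m.
Proof.
rewrite mulrDr mulrBr mulr1 !(mulrA p) coefD coefB coefMX coefMXn /= !coefMC !subSS subn0.
by ring.
Qed.

Lemma coef1_quadratic (p : {poly int}) (b c : int) :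
  (p * (1 - b%:P * 'X + c%:P * 'X^2))`_1 = p`_1 - b * p`_0.
Proof.
rewrite mulrDr mulrBr mulr1 !(mulrA p) coefD coefB coefMX coefMXn /= !coefMC.
by ring.
Qed.

End Frontier.

(** * Coefficients for forests with at most three and at most four levels *)

Lemma forest_gf_fib n : (forest_gf n.+1 4)`_n.+1 = (fib (2 * n))%:Z.
Proof.
set N := n.+1; set F := forest_gf N 4.
have F0 : F`_0 = 1 by apply: coef0_forest_gf.
have E m : (m <= N)%N ->
    (F * (1 - 3%:P * 'X + 1%:P * 'X^2))`_m = (1 - 2%:P * 'X : {poly int})`_m.
  apply: coef_forest_gf; have [r Er] := forest_gf_convergent (forest_gf_convergent
    (forest_gf_convergent (forest_gf1 N))).
  (* Starting from 1 / 1, each new denominator is the old one minus ['X] times the old numerator,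
     and the old denominator becomes the numerator. The denominators are 1 - X, 1 - 2X and 1 - 3X +
     X^2. *)
  have -> : (1 - 3%:P * 'X + 1%:P * 'X^2 : {poly int})
    = (1 - 'X * 1) - 'X * 1 - 'X * (1 - 'X * 1) by rewrite !polyC_natr; ring.
  exists r; rewrite Er; rewrite !polyC_natr; ring.
have F1 : F`_1 = 1.
  have := E 1%N isT; rewrite coef1_quadratic F0 coefB coefCM coefX coef1 /=; lia.
(* The numerator has degree 1, so the recurrence is homogeneous; every second Fibonacci number obeys
   the same one. *)
have FS m : (m.+2 <= N)%N -> F`_m.+2 = 3 * F`_m.+1 - F`_m.
  move=> /E; rewrite coef_quadratic coefB coefCM coefX coef1 /=; lia.
suff H m : (m <= n)%N -> F`_m.+1 = (fib (2 * m))%:Z by apply: H.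
have [k] := ubnP m; elim: k m => // k IHk [|[|m]] // ltm mn.
  by rewrite FS // F0 F1.
rewrite FS // !IHk; try lia.
by rewrite !mulnS !addSn !add0n /=; lia.
Qed.

Lemma forest_gf_pow3 n : (forest_gf n.+1 5)`_n.+1 = ((3 ^ n + 1) %/ 2)%:Z.
Proof.
set N := n.+1; set F := forest_gf N 5.
have F0 : F`_0 = 1 by apply: coef0_forest_gf.
have E m : (m <= N)%N ->
    (F * (1 - 4%:P * 'X + 3%:P * 'X^2))`_m
      = (1 * (1 - 3%:P * 'X + 1%:P * 'X^2) : {poly int})`_m.
  apply: coef_forest_gf; have [r Er] := forest_gf_convergent (forest_gf_convergent
    (forest_gf_convergent (forest_gf_convergent (forest_gf1 N)))).
  have -> : (1 - 4%:P * 'X + 3%:P * 'X^2 : {poly int})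
    = (1 - 'X * 1) - 'X * 1 - 'X * (1 - 'X * 1) - 'X * ((1 - 'X * 1) - 'X * 1)
    by rewrite !polyC_natr; ring.
  exists r; rewrite Er; rewrite !polyC_natr; ring.
have F1 : F`_1 = 1.
  have := E 1%N isT; rewrite !coef1_quadratic F0 !coef1 /=; lia.
(* The correction at [m = 0] is the coefficient of X^2 in the numerator. Beyond it the
   characteristic roots are 1 and 3. *)
have FS m : (m.+2 <= N)%N -> F`_m.+2 = 4 * F`_m.+1 - 3 * F`_m + (m == 0%N).
  move=> /E; rewrite !coef_quadratic !coef1 /=; case: m => [|m] /=; lia.
(* Doubling keeps the induction free of integer division. *)
suff H m : (m <= n)%N -> 2 * F`_m.+1 = (3 ^ m + 1)%:Z.
  by have := H n (leqnn _); rewrite -/N; lia.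
have [k] := ubnP m; elim: k m => // k IHk [|[|m]] // ltm mn.
- by rewrite F1.
- by rewrite FS // F0 F1.
have := FS m.+1 mn; have := IHk m.+1; have := IHk m; rewrite !expnS.
by move=> H1 H2 ->; move: H1 H2; lia.
Qed.

(** * The Cartan subalgebra *)

Section Diagonalization.
Variables (K : numClosedFieldType) (n : nat).
Local Notation A := 'M[K]_n.+1.

(* If v is an eigenrow of x and y an eigenvector of ad x, then v y is zero or
   an eigenrow of x; and such rows v y span everything. *)
Lemma ad_diagonalizable_diagonalizable (x : A) :
  ad_diagonalizable (sl K n) x -> diagonalizable x.
Proof.
case=> s sb sad.
have [rs0 Ers] := closed_field_poly_normal (char_poly x).
rewrite (monicP (char_poly_monic x)) scale1r in Ers.
pose rs := undup rs0; pose S := (\sum_(r <- rs) eigenspace x r)%MS.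
have eigS (w : 'rV[K]_n.+1) c : w *m x = c *: w -> (w <= S)%MS.
  move=> wx; have [->|w0] := eqVneq w 0; first exact: sub0mx.
  have crs : c \in rs.
    have : eigenvalue x c by apply/eigenvalueP; exists w.
    by rewrite eigenvalue_root_char Ers root_prod_XsubC mem_undup.
  apply: (@submx_trans _ _ _ _ _ _ (eigenspace x c)); first exact/eigenspaceP.
  by rewrite /S (bigD1_seq c) ?undup_uniq //= addsmxSl.
have [a /eigenvalueP[v vx v0]] : exists a, eigenvalue x a.
  by apply: eigenvalue_closed.
have vyS (y : A) : y \in s -> (v *m y <= S)%MS.
  (* If [[x, y] = c y], then [v y x = v (x y - c y) = (a - c) v y]. *)
  move=> /sad[c]; rewrite adE => xy; apply: (eigS _ (a - c)).
  have -> : v *m y *m x = v *m (y * x) by rewrite mulmxA.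
  have -> : y * x = x * y - c *: y by rewrite -xy opprB addrC subrK.
  by rewrite mulmxBr mulmxA vx -scalemxAl -scalemxAr scalerBl.
have vgS (y : A) : (v *m y <= S)%MS.
  (* Subtracting a scalar makes [y] traceless, and the scalar only contributes a multiple of [v]. *)
  pose t := \tr y / n.+1%:R.
  have ysl : y - t%:M \in sl K n.
    rewrite slP raddfB /= mxtrace_scalar -[t *+ _]mulr_natr divfK ?subrr //.
    by rewrite pnatr_eq0.
  rewrite -[y](subrK t%:M) mulmxDr addmx_sub //; last first.
    by rewrite mul_mx_scalar scalemx_sub // (eigS _ a).
  have sb' : basis_of (sl K n) (in_tuple s) by [].
  rewrite (coord_basis sb' ysl) mulmx_sumr summx_sub // => i _.
  by rewrite -scalemxAr scalemx_sub // vyS // mem_nth.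
apply/diagonalizablePeigen; exists rs; rewrite ?undup_uniq //.
apply/eqmxP; rewrite submx1 /=; apply/row_subP => i.
have [j vj] : exists j, v 0 j != 0 by apply/rV0Pn.
(* Since [v] has a nonzero entry, every row is [v y] for some [y] of rank at most one. *)
have -> : row i 1%:M = v *m ((v 0 j)^-1 *: (delta_mx j 0 *m row i 1%:M)).
  rewrite -scalemxAr mulmxA (_ : v *m delta_mx j 0 = (v 0 j)%:M).
    by rewrite mul_scalar_mx scalerA mulVf ?scale1r.
  by rewrite -colE; apply/matrixP=> p q; rewrite !ord1 !mxE eqxx mulr1n.
exact: vgS.
Qed.

(** For invertible [P], the matrix of [x] acting on row vectors, in the basis formed by the rows of
    [P]. *)
Definition in_basis (P x : A) : A := P * x * P^-1.

Lemma in_basis_is_linear P : linear (in_basis P).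
Proof. by move=> a x y; rewrite /in_basis mulrDr mulrDl -scalerAr -scalerAl. Qed.

HB.instance Definition _ P :=
  GRing.isLinear.Build K A A _ (in_basis P) (in_basis_is_linear P).

Lemma in_basisM P x y : P \is a GRing.unit -> in_basis P (x * y) = in_basis P x * in_basis P y.
Proof. by move=> uP; rewrite /in_basis !mulrA mulrVK. Qed.

Lemma in_basisK P : P \is a GRing.unit -> cancel (in_basis P^-1) (in_basis P).
Proof. by move=> uP x; rewrite /in_basis invrK !mulrA mulrV // mul1r mulrK. Qed.

Lemma in_basisVK P : P \is a GRing.unit -> cancel (in_basis P) (in_basis P^-1).
Proof. by move=> uP x; rewrite /in_basis invrK !mulrA mulVr // mul1r mulrVK. Qed.

Lemma mxtrace_in_basis P x : P \is a GRing.unit -> \tr (in_basis P x) = \tr x.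
Proof. by move=> uP; rewrite /in_basis mxtrace_mulC mulKmx. Qed.

Lemma in_basis_ad P x y : P \is a GRing.unit ->
  in_basis P (ad x y) = in_basis P x * in_basis P y - in_basis P y * in_basis P x.
Proof. by move=> uP; rewrite adE raddfB /= !in_basisM. Qed.

Lemma is_diag_mxE (x : A) : is_diag_mx x -> x = diag_mx (\row_i x i i).
Proof.
move/is_diag_mxP=> xd; apply/matrixP=> i j; rewrite !mxE.
by case: (eqVneq i j) => [->|/xd->]; rewrite ?mulr1n ?mulr0n.
Qed.

Lemma diag_mx_bracket (d y : A) i j : is_diag_mx d ->
  (d * y - y * d) i j = (d i i - d j j) * y i j.
Proof.
move/is_diag_mxE => ->; rewrite -!mulmxE mul_diag_mx mul_mx_diag !mxE.
by rewrite !eqxx !mulr1n mulrBl [y i j * _]mulrC.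
Qed.

(** Commuting diagonalizable elements share an eigenbasis. Conversely, a traceless diagonal element
    commutes with all of [h], hence belongs to [h], which is self-centralizing. *)
Lemma cartan_diagonal (h : {vspace A}) : cartan_subalgebra (sl K n) h ->
  exists2 P : A, P \is a GRing.unit
    & forall x, (x \in h) = (\tr x == 0) && is_diag_mx (in_basis P x).
Proof.
case=> hsl habel hself had.
have [P uP /allP Pdiag] : codiagonalizable (vbasis h : seq A).
  apply/codiagonalizableP; split=> [x y /vbasis_mem xh /vbasis_mem yh|x /vbasis_mem xh].
    by have := habel x y xh yh; rewrite adE => /subr0_eq.
  exact/ad_diagonalizable_diagonalizable/had.
have hdiag x : x \in h -> is_diag_mx (in_basis P x).
  move=> xh; rewrite (coord_vbasis xh) linear_sum; apply/is_diag_mxP=> i j ij.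
  rewrite summxE big1 // => k _; rewrite linearZ mxE.
  have : is_diag_mx (conjmx P (vbasis h)`_k).
    by apply: Pdiag; rewrite mem_nth ?size_tuple.
  by rewrite conjumx // => /is_diag_mxP/(_ i j ij) E; rewrite [X in _ * X]E mulr0.
exists P => // x; apply/idP/andP=> [xh|[trx xd]].
  by split; [rewrite -slP (subvP hsl)|apply: hdiag].
apply: hself; rewrite ?slP // => z zh; apply: (can_inj (in_basisVK uP)).
rewrite in_basis_ad // raddf0; apply/matrixP=> i j.
rewrite diag_mx_bracket ?hdiag // [in RHS]mxE; have /is_diag_mxP xd' := xd.
by case: (eqVneq i j) => [->|/xd'->]; rewrite ?subrr ?mul0r ?mulr0.
Qed.

End Diagonalization.

(** * Roots and the Borel subalgebra *)

Section UnitMatrices.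
Variables (K : numClosedFieldType) (n : nat) (P : 'M[K]_n.+1).
Hypothesis uP : P \is a GRing.unit.
Local Notation A := 'M[K]_n.+1.
Implicit Types (i j k l : 'I_n.+1).

Definition unit_elt i j : A := in_basis P^-1 (delta_mx i j).
Definition coroot i j : A := unit_elt i i - unit_elt j j.

Lemma in_basis_unit_elt i j : in_basis P (unit_elt i j) = delta_mx i j.
Proof. exact: in_basisK. Qed.

Lemma unit_elt_sum x : x = \sum_i \sum_j in_basis P x i j *: unit_elt i j.
Proof.
rewrite -[LHS](in_basisVK uP) {1}(matrix_sum_delta (in_basis P x)) linear_sum.
by apply: eq_bigr => i _; rewrite linear_sum; apply: eq_bigr => j _; rewrite linearZ.
Qed.

Lemma mxtrace_unit_elt i j : \tr (unit_elt i j) = (i == j)%:R.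
Proof.
rewrite -(mxtrace_in_basis _ uP) in_basis_unit_elt /mxtrace.
rewrite (bigD1 i) //= big1 ?addr0 ?mxE ?eqxx //= => k ki.
by rewrite mxE (negPf ki).
Qed.

Lemma mxtrace_coroot i j : \tr (coroot i j) = 0.
Proof. by rewrite raddfB /= !mxtrace_unit_elt !eqxx subrr. Qed.

Lemma in_basis_coroot i j : in_basis P (coroot i j) = delta_mx i i - delta_mx j j.
Proof. by rewrite raddfB /= !in_basis_unit_elt. Qed.

Lemma coroot_diag i j : is_diag_mx (in_basis P (coroot i j)).
Proof.
rewrite in_basis_coroot; apply/is_diag_mxP=> k l kl; rewrite !mxE.
suff E a : (k == a) && (l == a) = false by rewrite !E subrr.
by apply: contraNF kl => /andP[/eqP-> /eqP->].
Qed.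

Lemma coroot_eigen i j k l :
  in_basis P (coroot i j) k k - in_basis P (coroot i j) l l
    = (k == i)%:R - (k == j)%:R - ((l == i)%:R - (l == j)%:R).
Proof. by rewrite in_basis_coroot !mxE !andbb. Qed.

Lemma ad_unit_elt i j k l :
  ad (unit_elt i j) (unit_elt k l)
    = (j == k)%:R *: unit_elt i l - (l == i)%:R *: unit_elt k j.
Proof.
apply: (can_inj (in_basisVK uP)); rewrite in_basis_ad // !in_basis_unit_elt.
rewrite linearB 2!linearZ /= !in_basis_unit_elt -!mulmxE !mul_delta_mx_cond.
by rewrite !scaler_nat.
Qed.

End UnitMatrices.

Section Borel.
Variables (K : numClosedFieldType) (n : nat).
Local Notation A := 'M[K]_n.+1.
Variables (h : {vspace A}) (P : A).
Hypothesis uP : P \is a GRing.unit.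
Hypothesis hP : forall x, (x \in h) = (\tr x == 0) && is_diag_mx (in_basis P x).
Implicit Types (i j k l : 'I_n.+1).

Definition weight k l (H : subvs_of h) : K^o :=
  in_basis P (vsval H) k k - in_basis P (vsval H) l l.

Lemma weight_is_linear k l : linear (weight k l).
Proof.
move=> a x y; rewrite /weight !linearP !mxE /=.
by rewrite /GRing.scale /=; ring.
Qed.

HB.instance Definition _ k l :=
  GRing.isLinear.Build K (subvs_of h) K^o _ (weight k l) (weight_is_linear k l).

(** The classical root [e_k - e_l], where [e_k] reads off the [k]-th diagonal entry; it is zero for
    [k = l]. *)
Definition sl_root k l : dual h := linfun (weight k l).

Lemma sl_rootE k l H : sl_root k l H = weight k l H.
Proof. exact: lfunE. Qed.

Lemma in_basis_ad_cartan (H : subvs_of h) y k l :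
  in_basis P (ad (vsval H) y) k l = weight k l H * in_basis P y k l.
Proof.
rewrite in_basis_ad // diag_mx_bracket //.
by have := subvsP H; rewrite hP => /andP[].
Qed.

(** [ad H] multiplies the [(k, l)] entry by [weight k l H], so one nonzero entry determines the
    eigenvalues. *)
Lemma root_space_sl_root alpha y k l :
  y \in root_space (sl K n) alpha -> in_basis P y k l != 0 -> alpha = sl_root k l.
Proof.
move=> /root_spaceP[_ yH] ykl; apply/lfunP=> H; rewrite sl_rootE.
apply: (mulIf ykl); rewrite -in_basis_ad_cartan yH linearZ.
by rewrite [RHS]mxE.
Qed.

Lemma unit_elt_root_space k l : k != l ->
  unit_elt P k l \in root_space (sl K n) (sl_root k l).
Proof.
move=> kl; apply/root_spaceP; split=> [|H].
  by rewrite slP mxtrace_unit_elt // (negPf kl).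
apply: (can_inj (in_basisVK uP)); apply/matrixP=> i j.
rewrite in_basis_ad_cartan linearZ /= [RHS]mxE sl_rootE in_basis_unit_elt // mxE.
by have [/andP[/eqP-> /eqP->]|_] := boolP ((i == k) && (j == l)); rewrite ?mulr0.
Qed.

Lemma is_root_sl_root k l : is_root (sl K n) (sl_root k l) = (k != l).
Proof.
apply/andP/idP => [[a0 _]|kl].
  apply: contraNneq a0 => ->; apply/eqP/lfunP=> H.
  by rewrite sl_rootE /weight subrr lfunE.
have ch : coroot P k l \in h by rewrite hP mxtrace_coroot // eqxx coroot_diag.
split.
  (* The value at [coroot k l] is 2, so the functional is not zero. *)
  apply/eqP=> E; have := sl_rootE k l (Subvs ch); rewrite E lfunE /weight /=.
  rewrite coroot_eigen // !eqxx (negPf kl) eq_sym (negPf kl) /=.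
  by move/esym/eqP; rewrite subr0 sub0r opprK -natrD pnatr_eq0.
apply: contraTneq (unit_elt_root_space kl) => ->; rewrite memv0.
apply/negP=> /eqP /(congr1 (in_basis P)); rewrite in_basis_unit_elt // raddf0.
by move/matrixP/(_ k l)/eqP; rewrite !mxE !eqxx oner_eq0.
Qed.

Variable Dp : seq (dual h).
Hypothesis DpP : positive_roots (sl K n) Dp.

(** Positivity becomes a relation on indices. It turns out to be a strict total order, the one in
    which the basis will be listed. *)
Definition root_lt k l := sl_root k l \in Dp.

Lemma sl_rootN k l : - sl_root k l = sl_root l k.
Proof. by apply/lfunP=> H; rewrite opp_lfunE !sl_rootE /weight opprB. Qed.

Lemma sl_rootD j k l : sl_root j k + sl_root k l = sl_root j l.
Proof.
by apply/lfunP=> H; rewrite add_lfunE !sl_rootE /weight addrA subrK.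
Qed.

Lemma root_ltxx k : root_lt k k = false.
Proof. by case: DpP => D1 _ _; apply/negP=> /D1; rewrite is_root_sl_root eqxx. Qed.

Lemma root_lt_total k l : k != l -> root_lt k l = ~~ root_lt l k.
Proof. by case: DpP => _ D2 _ kl; rewrite /root_lt D2 ?is_root_sl_root // sl_rootN. Qed.

Lemma root_lt_trans : transitive root_lt.
Proof.
move=> k j l jk kl; have [D1 _ D3] := DpP.
have jl : j != l.
  apply: contraTneq jk => ->; rewrite root_lt_total ?kl //.
  by rewrite eq_sym -is_root_sl_root; apply: D1.
by rewrite /root_lt -(sl_rootD j k l) D3 // sl_rootD is_root_sl_root.
Qed.

Lemma borel_root_lt x : x \in borel (sl K n) Dp <->
  \tr x = 0 /\ forall k l, k != l -> ~~ root_lt k l -> in_basis P x k l = 0.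
Proof.
split.
  move=> /memv_addP[y yh [z zD ->]].
  have [tz zkl] : \tr z = 0 /\ forall k l, ~~ root_lt k l -> in_basis P z k l = 0.
    (* The induction runs over a list contained in [Dp], while [root_lt] keeps referring to all of
       [Dp]. *)
    have : {subset Dp <= Dp} by [].
    move: z zD; elim: {1 2}Dp => [|a s IHs] z; first rewrite big_nil memv0 => /eqP -> _.
      by rewrite !raddf0; split=> // *; rewrite mxE.
    rewrite big_cons => /memv_addP[u ua [w ws ->]] sD.
    have [tw wkl] := IHs w ws (fun b bs => sD b (mem_behead (s := a :: s) bs)).
    split=> [|k l nkl].
      have /root_spaceP[] := ua; rewrite slP => /eqP tu _.
      by rewrite raddfD /= tu tw addr0.
    rewrite raddfD mxE /= wkl // addr0; apply/eqP; apply: contraNT nkl => ukl.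
    by rewrite /root_lt -(root_space_sl_root ua ukl) sD ?mem_head.
  move: yh; rewrite hP => /andP[/eqP ty /is_diag_mxP yd].
  split=> [|k l kl nkl]; first by rewrite raddfD /= ty tz addr0.
  by rewrite raddfD mxE /= zkl // yd // addr0.
case=> tx xkl.
(* [y] is the off-diagonal part of [x]; what remains is diagonal and traceless, hence in [h]. *)
pose y := \sum_k \sum_(l | l != k) in_basis P x k l *: unit_elt P k l.
have yE k l : in_basis P y k l = (l != k)%:R * in_basis P x k l.
  rewrite /y linear_sum summxE (bigD1 k) //= [X in _ + X]big1 => [|k' k'k].
    rewrite addr0 linear_sum summxE.
    have [->|lk] := eqVneq l k.
      rewrite mul0r big1 // => l' l'k.
      by rewrite linearZ /= in_basis_unit_elt // !mxE [k == l']eq_sym (negPf l'k) andbF mulr0.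
    rewrite (bigD1 l) //= big1 => [|l' /andP[_ l'l]].
      by rewrite linearZ /= in_basis_unit_elt // !mxE !eqxx mulr1 mul1r addr0.
    by rewrite linearZ /= in_basis_unit_elt // !mxE [l == _]eq_sym (negPf l'l) andbF mulr0.
  rewrite linear_sum summxE big1 // => l' _.
  by rewrite linearZ /= in_basis_unit_elt // !mxE [k == _]eq_sym (negPf k'k) mulr0.
rewrite -[x](subrK y); apply: memv_add.
  rewrite hP; apply/andP; split.
    rewrite raddfB /= tx sub0r oppr_eq0 raddf_sum big1 //= => k _.
    rewrite raddf_sum big1 //= => l lk.
    by rewrite mxtraceZ mxtrace_unit_elt // eq_sym (negPf lk) mulr0.
  apply/is_diag_mxP=> k l kl; rewrite raddfB /= mxE [X in _ + X]mxE yE eq_sym.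
  by rewrite val_eqE in kl; rewrite kl mul1r subrr.
apply: memv_suml => k _; apply: memv_suml => l lk.
have [kl|/negPf nkl] := boolP (root_lt k l); last first.
  by rewrite xkl 1?eq_sym // ?nkl // scale0r mem0v.
have : unit_elt P k l \in root_space (sl K n) (sl_root k l).
  by rewrite unit_elt_root_space // eq_sym.
move/(memvZ (in_basis P x k l)); apply/subvP.
by rewrite (big_rem _ kl) /= addvSl.
Qed.

End Borel.

(** * Reordering the basis by the positive roots *)

Lemma strict_order_perm (N : nat) (r : rel 'I_N) :
  irreflexive r -> transitive r -> (forall i j, i != j -> r i j = ~~ r j i) ->
  exists s : {perm 'I_N}, forall i j, r (s i) (s j) = (i < j)%N.
Proof.
move=> rxx rtr rtot; pose below i := [set j | r j i].
have below_lt i : (#|below i| < N)%N.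
  rewrite -[X in (_ < X)%N]card_ord -cardsT; apply: proper_card.
  by rewrite properT; apply/eqP=> /finset.setP/(_ i); rewrite !inE rxx.
have below_mono i j : r i j -> (#|below i| < #|below j|)%N.
  move=> rij; apply: proper_card; apply/properP; split.
    by apply/fintype.subsetP=> k; rewrite !inE => /rtr; apply.
  by exists i; rewrite !inE ?rxx.
(* An index is ranked by the number of indices below it; the permutation sought is the inverse of
   this ranking. *)
pose rank i := Ordinal (below_lt i).
have rank_inj : injective rank.
  move=> i j [] E; apply/eqP; apply: contraT => ij.
  case: (boolP (r i j)) => [/below_mono|]; first by rewrite E ltnn.
  by rewrite rtot // negbK => /below_mono; rewrite E ltnn.
have rankE i j : r i j = (rank i < rank j)%N.
  apply/idP/idP=> [/below_mono //|]; apply: contraTT => nij.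
  rewrite -leqNgt; have [->//|ij] := eqVneq i j.
  by rewrite ltnW //; apply: below_mono; rewrite rtot // eq_sym.
exists (perm rank_inj)^-1%g => i j.
by rewrite rankE -!(permE rank_inj) !permKV.
Qed.

Section Triangular.
Variables (K : numClosedFieldType) (n : nat).
Local Notation A := 'M[K]_n.+1.

Lemma in_basis_perm (s : {perm 'I_n.+1}) (P x : A) i j : P \is a GRing.unit ->
  in_basis (perm_mx s * P) x i j = in_basis P x (s i) (s j).
Proof.
move=> uP; have us : (perm_mx s : A) \is a GRing.unit by apply: unitmx_perm.
have -> : in_basis (perm_mx s * P) x = perm_mx s *m (in_basis P x *m perm_mx s^-1).
  by rewrite perm_mxV !mulmxE /in_basis invrM // !mulrA.
by rewrite -col_permE -row_permE mxE [LHS]mxE.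
Qed.

Lemma borel_upper_triangular (h : {vspace A}) (Dp : seq (dual h)) :
  cartan_subalgebra (sl K n) h -> positive_roots (sl K n) Dp ->
  exists2 P : A, P \is a GRing.unit &
    forall x, x \in borel (sl K n) Dp <->
      \tr x = 0 /\ forall i j : 'I_n.+1, (j < i)%N -> in_basis P x i j = 0.
Proof.
move=> /cartan_diagonal[P uP hP] DpP.
have [s sE] := strict_order_perm (root_ltxx uP hP DpP) (@root_lt_trans _ _ _ _ uP hP _ DpP)
  (root_lt_total uP hP DpP).
exists (perm_mx s * P); first by rewrite unitrMl // unitmx_perm.
move=> x; rewrite (borel_root_lt uP hP); split=> -[tx xE]; split=> // i j.
  move=> ji; rewrite in_basis_perm // xE ?sE -?leqNgt 1?ltnW //.
  by rewrite (inj_eq perm_inj) -val_eqE gtn_eqF.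
move=> ij nij; have := xE (s^-1%g i) (s^-1%g j).
rewrite in_basis_perm // !permKV; apply; rewrite ltnNge leq_eqVlt negb_or.
rewrite -sE !permKV nij andbT.
by rewrite val_eqE (inj_eq perm_inj).
Qed.

End Triangular.

(** * Ad-nilpotent ideals *)

(** Once a power vanishes, so do all later ones; conversely a vanishing power yields a least one. *)
Lemma class_at_mostP (K : fieldType) (L : falgType K) (J : {vspace L}) k :
  class_at_most J k <-> lpow J k.+1 = 0%VS.
Proof.
split=> [[m [Jm _] mk]|Jk].
  rewrite -(subnK mk); elim: (k - m)%N => //= d IHd.
  apply/eqP; rewrite -subv0 /lpow /= -[iter _ _ _]/(lpow J (d + m).+1) IHd.
  by apply/liebrvP=> u v; rewrite !memv0 => /eqP-> _; rewrite mul0r mulr0 subrr.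
have ex : exists m, lpow J m.+1 == 0%VS by exists k; apply/eqP.
case: (ex_minnP ex) => m /eqP Jm min_m; exists m; last by apply/min_m/eqP.
by split=> // l Jl; apply/min_m/eqP.
Qed.

(** * Staircase subspaces and their powers *)

Section Staircase.
Variables (K : numClosedFieldType) (n : nat) (P : 'M[K]_n.+1).
Hypothesis uP : P \is a GRing.unit.
Local Notation A := 'M[K]_n.+1.
Local Notation E := (unit_elt P).
Implicit Types (i j k l : 'I_n.+1) (f g : nat -> nat).

(** Collects the entries required to vanish, so that the staircase subspace is a kernel. *)
Definition mask g (x : A) : A :=
  \matrix_(i, j) (if (j < g i)%N then in_basis P x i j else 0).

Lemma maskE g x i j : mask g x i j = if (j < g i)%N then in_basis P x i j else 0.
Proof. by rewrite mxE. Qed.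

Lemma mask_is_linear g : linear (mask g).
Proof.
move=> a x y; apply/matrixP=> i j; rewrite maskE linearP [RHS]mxE.
rewrite [X in _ = X + _]mxE !maskE.
by case: ifP => _; rewrite ?mulr0 ?addr0 // mxE [X in X + _ = _]mxE.
Qed.

HB.instance Definition _ g :=
  GRing.isLinear.Build K A A _ (mask g) (mask_is_linear g).

Definition staircase g : {vspace A} := lker (linfun (mask g)).

Lemma staircaseP g x :
  reflect (forall i j, (j < g i)%N -> in_basis P x i j = 0) (x \in staircase g).
Proof.
rewrite memv_ker lfunE; apply: (iffP eqP) => [/matrixP E0 i j ji|E0].
  by have := E0 i j; rewrite mxE [RHS]mxE ji.
by apply/matrixP=> i j; rewrite mxE [RHS]mxE; case: ifP => // /E0.
Qed.

Lemma unit_elt_staircase g i j : (E i j \in staircase g) = (g i <= j)%N.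
Proof.
apply/staircaseP/idP => [E0|gij k l]; last first.
  rewrite in_basis_unit_elt // mxE; case: andP => // -[/eqP-> /eqP->].
  by rewrite ltnNge gij.
rewrite leqNgt; apply/negP=> /E0/eqP.
by rewrite in_basis_unit_elt // mxE !eqxx oner_eq0.
Qed.

Lemma in_basis_ad_entry (x y : A) i j : in_basis P (ad x y) i j =
  \sum_k (in_basis P x i k * in_basis P y k j) - \sum_k (in_basis P y i k * in_basis P x k j).
Proof. by rewrite in_basis_ad // mxE [X in _ + X]mxE -!mulmxE [X in X - _]mxE [X in _ - X]mxE. Qed.

Lemma in_basis_eq (x y : A) : (forall i j, in_basis P x i j = in_basis P y i j) -> x = y.
Proof. by move=> xy; apply: (can_inj (in_basisVK uP)); apply/matrixP. Qed.

(** A nonzero term of [u v] at [(i, j)] passes through some [k >= g i] with [j >= f k >= f (g i)].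
    The product [v u] gives [g (f i)] instead, whence the commutation hypothesis. *)
Lemma liebrv_staircase f g :
  {homo f : i j / (i <= j)%N} -> {homo g : i j / (i <= j)%N} ->
  (forall i, f (g i) = g (f i)) ->
  (liebrv (staircase g) (staircase f) <= staircase (f \o g))%VS.
Proof.
move=> fM gM fg; apply/liebrvP=> u v /staircaseP u0 /staircaseP v0.
rewrite -adE; apply/staircaseP=> i j /= ji; rewrite in_basis_ad_entry.
rewrite !big1 ?subrr // => k _.
  have [/v0->|ik] := ltnP k (f i); first by rewrite mul0r.
  by rewrite u0 ?mulr0 // (leq_trans ji) // fg gM.
have [/u0->|ik] := ltnP k (g i); first by rewrite mul0r.
by rewrite v0 ?mulr0 // (leq_trans ji) // fM.
Qed.

Lemma iter_homo f m : {homo f : i j / (i <= j)%N} -> {homo iter m f : i j / (i <= j)%N}.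
Proof. by move=> fM i j ij; elim: m => //= m; apply: fM. Qed.

Lemma lpow_staircase f m : {homo f : i j / (i <= j)%N} ->
  (lpow (staircase f) m.+1 <= staircase (iter m.+1 f))%VS.
Proof.
move=> fM; elim: m => [|m IHm]; first exact: subvv.
apply: subv_trans (liebrv_staircase fM (iter_homo m.+1 fM) _); last first.
  by move=> i; rewrite -iterS -iterSr.
apply/liebrvP=> u v um vf; move: (subvP IHm _ um) => um'.
by apply/(liebrvP _ _ _ (subvv _)).
Qed.

Lemma iter_ext_bounds (f : {ffun 'I_n.+1 -> 'I_n.+2}) m (j : nat) : frontier f ->
  (j <= n.+1)%N -> (j <= iter m (ext f) j <= n.+1)%N.
Proof.
move=> /frontierP[f1 _] jN; elim: m => [|m /andP[IH1 IH2]]; first by rewrite leqnn.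
rewrite iterS ext_le andbT; apply: (leq_trans IH1).
have [/f1/ltnW//|/(ext_ge f)->//] := ltnP (iter m (ext f) j) n.+1.
Qed.

(** Induction through [E i j = [E i k, E k j]], where [k] is the previous iterate at [i]: the first
    factor lies in the previous power and the second in the staircase. *)
Lemma unit_elt_lpow (f : {ffun 'I_n.+1 -> 'I_n.+2}) m i j : frontier f ->
  (iter m.+1 (ext f) i <= j)%N -> E i j \in lpow (staircase (ext f)) m.+1.
Proof.
move=> fF; have /frontierP[f1 fM] := fF.
elim: m j => [|m IHm] j; first by rewrite unit_elt_staircase.
rewrite iterS; set k := iter m.+1 (ext f) i => fkj.
have ik : (i < k)%N.
  have /andP[+ _] := iter_ext_bounds m fF (ext_le f i).
  by rewrite -iterSr; apply: leq_trans; apply: f1.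
have kN : (k < n.+1)%N.
  by have [//|/(ext_ge f)] := ltnP k n.+1; have := ltn_ord j; lia.
have kj := leq_trans (f1 _ kN) fkj.
have -> : E i j = ad (E i (Ordinal kN)) (E (Ordinal kN) j).
  rewrite ad_unit_elt // eqxx scale1r (_ : (j == i) = false) ?scale0r ?subr0 //.
  by apply/eqP=> ji; move: kj; rewrite ji ltnNge ltnW.
rewrite adE; apply: (liebrvP _ _ _ (subvv _)); first exact: IHm.
by rewrite unit_elt_staircase.
Qed.

(** By monotonicity row 0 starts furthest to the left, so its last entry, that of [E ord0 ord_max],
    is the last to die. *)
Lemma lpow_staircase_eq0 (f : {ffun 'I_n.+1 -> 'I_n.+2}) m : frontier f ->
  lpow (staircase (ext f)) m.+1 = 0%VS <-> iter m.+1 (ext f) 0 = n.+1.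
Proof.
move=> fF; have /frontierP[f1 fM] := fF; split=> [l0|fN].
  have /andP[_] := iter_ext_bounds m.+1 fF (leq0n _).
  rewrite leq_eqVlt => /predU1P[//|]; rewrite ltnS.
  move/(unit_elt_lpow (i := ord0) (j := ord_max) fF); rewrite l0 memv0.
  move=> /eqP/(congr1 (in_basis P)); rewrite in_basis_unit_elt // raddf0.
  by move/matrixP/(_ ord0 ord_max)/eqP; rewrite !mxE !eqxx oner_eq0.
apply/eqP; rewrite -subv0; apply: subv_trans (lpow_staircase m fM) _.
apply/subvP=> x /staircaseP x0; rewrite memv0; apply/eqP/in_basis_eq=> i j.
rewrite raddf0 [RHS]mxE x0 //; apply: leq_trans (ltn_ord j) _.
by rewrite -[X in (X <= _)%N]fN; apply: iter_homo.
Qed.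

Lemma staircase_inj :
  injective (fun f : {ffun 'I_n.+1 -> 'I_n.+2} => staircase (ext f)).
Proof.
move=> f1 f2 E12; apply: ext_inj => j jN.
have H (k : nat) : (ext f1 j <= k)%N = (ext f2 j <= k)%N.
  have [kN|kN] := ltnP k n.+1; last by rewrite !(leq_trans _ kN) // ext_le.
  have := unit_elt_staircase (ext f1) (Ordinal jN) (Ordinal kN).
  by rewrite E12 unit_elt_staircase.
by apply/eqP; rewrite eqn_leq H leqnn -H leqnn.
Qed.

(** * Every ad-nilpotent ideal is a staircase *)

Section Ideals.
Variable b : {vspace A}.
Hypothesis bP : forall x, x \in b <->
  \tr x = 0 /\ forall i j, (j < i)%N -> in_basis P x i j = 0.

Lemma unit_elt_borel i j : (i < j)%N -> E i j \in b.
Proof.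
move=> ij; apply/bP; split=> [|k l lk].
  by rewrite mxtrace_unit_elt // -val_eqE (ltn_eqF ij).
rewrite in_basis_unit_elt // mxE; case: andP => // -[/eqP ki /eqP lj].
by move: lk; rewrite ki lj ltnNge ltnW.
Qed.

Lemma coroot_borel i j : coroot P i j \in b.
Proof.
apply/bP; split=> [|k l lk]; first exact: mxtrace_coroot.
have /is_diag_mxP -> // := coroot_diag uP i j.
by rewrite gtn_eqF.
Qed.

Lemma ad_strictly_upper_nilpotent x : (forall i j, (j <= i)%N -> in_basis P x i j = 0) ->
  forall y, iter (2 * n.+1) (ad x) y = 0.
Proof.
move=> x0 y; apply: in_basis_eq => i j; rewrite raddf0 [RHS]mxE.
(* Each bracket with [x] raises the least possible [j - i] by one: after [t] of them the entry
   [(i, j)] vanishes if [j + n.+1 < i + t]. For [t = 2 * n.+1] this covers all entries. *)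
have : (j + n.+1 < i + 2 * n.+1)%N by have := ltn_ord j; lia.
elim: (2 * n.+1)%N i j => [|t IHt] i j; first by have := ltn_ord i; lia.
move=> jit; rewrite iterS in_basis_ad_entry !big1 ?subrr // => k _.
  have [jk|kj] := leqP j k; first by rewrite [in_basis P x k j]x0 ?mulr0.
  by rewrite IHt ?mul0r //; lia.
have [ki|ik] := leqP k i; first by rewrite x0 ?mul0r.
by rewrite IHt ?mulr0 //; lia.
Qed.

Lemma staircase_ideal f : {homo f : i j / (i <= j)%N} ->
  (forall j, (j < n.+1)%N -> (j < f j)%N) -> ad_nilpotent_ideal b (staircase f).
Proof.
move=> fM f1; split.
  apply/andP; split.
    apply/subvP=> x /staircaseP x0; apply/bP; split=> [|i j ji].
      by rewrite -(mxtrace_in_basis x uP) /mxtrace big1 // => i _; rewrite x0 ?f1.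
    by rewrite x0 // (ltn_trans ji) // f1.
  apply/liebrvP=> u v /bP[_ u0] /staircaseP v0.
  rewrite -adE; apply/staircaseP=> i j ji; rewrite in_basis_ad_entry !big1 ?subrr // => k _.
    have [/v0->|ik] := ltnP k (f i); first by rewrite mul0r.
    by rewrite u0 ?mulr0 // (leq_trans ji).
  have [/u0->|ik] := ltnP k i; first by rewrite mul0r.
  by rewrite v0 ?mulr0 // (leq_trans ji) // fM.
move=> x /staircaseP x0; exists (2 * n.+1)%N => y _.
apply: ad_strictly_upper_nilpotent => i j ji.
by rewrite x0 // (leq_ltn_trans ji) // f1.
Qed.

(** The iterates of [ad x] on [E i j] stay supported above and to the right of [(i, j)], and their
    entry there is a power of the difference of the two diagonal entries, which nilpotency forces to
    vanish. *)
Lemma ad_nilpotent_diag x i j : x \in b -> ad_nilpotent b x -> (i < j)%N ->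
  in_basis P x i i = in_basis P x j j.
Proof.
move=> /bP[_ x0] [t /(_ _ (unit_elt_borel _)) nil] ij.
pose Q (y : A) m := in_basis P y i j = (in_basis P x i i - in_basis P x j j) ^+ m
  /\ forall k l, ~~ ((k <= i) && (j <= l))%N -> in_basis P y k l = 0.
have Qt : Q (iter t (ad x) (E i j)) t.
  elim: (t) => [|m [IH1 IH2]].
    rewrite /Q in_basis_unit_elt // mxE !eqxx expr0; split=> // k l kl.
    rewrite mxE; have [/andP[/eqP ki /eqP lj]|//] := boolP ((k == i) && (l == j)).
    by rewrite ki lj !leqnn in kl.
  split; last first.
    move=> k l kl; rewrite iterS in_basis_ad_entry !big1 ?subrr // => m' _.
      have [/IH2->|] := boolP (~~ ((k <= i) && (j <= m'))%N); first by rewrite mul0r.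
      rewrite negbK => /andP[ki jm]; rewrite x0 ?mulr0 //.
      by move: kl; rewrite ki /= -ltnNge => lj; apply: leq_trans jm.
    have [/IH2->|] := boolP (~~ ((m' <= i) && (j <= l))%N); first by rewrite mulr0.
    rewrite negbK => /andP[mi jl]; rewrite x0 ?mul0r //.
    by move: kl; rewrite jl andbT -ltnNge; apply: leq_ltn_trans.
  rewrite iterS in_basis_ad_entry (bigD1 i) //= [X in _ + X - _]big1 => [|k ki].
    rewrite (bigD1 j) //= [X in _ - (_ + X)]big1 => [|k kj].
      by rewrite !addr0 IH1 exprS mulrBl [_ ^+ _ * in_basis P x j j]mulrC.
    have [jk|kj'] := ltnP j k; first by rewrite [in_basis P x k j]x0 ?mulr0.
    by rewrite IH2 ?mul0r // leqnn -ltnNge ltn_neqAle val_eqE kj.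
  have [ki'|ik] := ltnP k i; first by rewrite x0 ?mul0r.
  by rewrite IH2 ?mulr0 // leqnn andbT -ltnNge ltn_neqAle eq_sym val_eqE ki.
move: Qt => [+ _]; rewrite nil // raddf0 mxE => /esym/eqP.
by rewrite expf_eq0 subr_eq0 => /andP[_ /eqP].
Qed.

(** The diagonal entries all agree and sum to zero, hence vanish in characteristic 0. *)
Lemma ad_nilpotent_strictly_upper x : x \in b -> ad_nilpotent b x ->
  forall i j, (j <= i)%N -> in_basis P x i j = 0.
Proof.
move=> xb xnil i j; have /bP[tx x0] := xb.
rewrite leq_eqVlt => /predU1P[/val_inj->{j}|/x0 //].
have dE k : in_basis P x k k = in_basis P x i i.
  have [ki|ik|/val_inj->//] := ltngtP k i; first exact: ad_nilpotent_diag.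
  by apply/esym; apply: ad_nilpotent_diag.
move: tx; rewrite -(mxtrace_in_basis x uP) /mxtrace (eq_bigr _ (fun k _ => dE k)).
by rewrite sumr_const card_ord => /eqP; rewrite mulrn_eq0 => /eqP.
Qed.

(* The eigenvalues of t = ad (coroot i j) are at most 2, and only the line of
   [unit_elt i j] has eigenvalue 2, so (t + 2)(t + 1)(t - 1)t projects onto it. *)
Lemma unit_elt_component (J : {vspace A}) x i j : i != j ->
  (liebrv b J <= J)%VS -> x \in J -> in_basis P x i j != 0 -> E i j \in J.
Proof.
move=> ij bJ xJ xij.
pose t := ad (coroot P i j).
have tJ y : y \in J -> t y \in J.
  by move=> yJ; rewrite /t adE; apply: (liebrvP _ _ _ bJ) => //; apply: coroot_borel.
pose w k l : K := (k == i)%:R - (k == j)%:R - ((l == i)%:R - (l == j)%:R).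
have tE y k l : in_basis P (t y) k l = w k l * in_basis P y k l.
  by rewrite in_basis_ad // diag_mx_bracket ?coroot_diag // coroot_eigen.
pose x2 := t (t x) - t x; pose x3 := t x2 + x2; pose x4 := t x3 + x3 + x3.
have x2J : x2 \in J by rewrite memvB ?tJ.
have x3J : x3 \in J by rewrite memvD ?tJ.
have x4J : x4 \in J by rewrite memvD // memvD // tJ.
(* 24 = (2 + 2)(2 + 1)(2 - 1)2 is the value of the polynomial at the eigenvalue 2. *)
have x4E : x4 = (24%:R * in_basis P x i j) *: E i j.
  apply: in_basis_eq => k l; rewrite linearZ /= [RHS]mxE in_basis_unit_elt // [X in _ = _ * X]mxE.
  have DE y z : in_basis P (y + z) k l = in_basis P y k l + in_basis P z k l.
    by rewrite raddfD mxE.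
  have BE y z : in_basis P (y - z) k l = in_basis P y k l - in_basis P z k l.
    by rewrite raddfB /= mxE [X in _ + X]mxE.
  have E2 : in_basis P x2 k l = (w k l - 1) * w k l * in_basis P x k l.
    by rewrite BE !tE; ring.
  have E3 : in_basis P x3 k l = (w k l + 1) * in_basis P x2 k l.
    by rewrite DE tE; ring.
  have -> : in_basis P x4 k l =
      (w k l + 2%:R) * (w k l + 1) * (w k l - 1) * w k l * in_basis P x k l.
    by rewrite 2!DE tE E3 E2; ring.
  have ji : (j == i) = false by rewrite eq_sym (negPf ij).
  rewrite /w; have [->|ki] := eqVneq k i; last have [->|kj] := eqVneq k j.
  - have [->|lj] := eqVneq l j; first by rewrite ?eqxx ?ji ?(negPf ij) /=; ring.
    by rewrite ?eqxx ?(negPf ij); case: (l == i) => /=; ring.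
  - have [->|li] := eqVneq l i; first by rewrite ?eqxx ?ji ?(negPf ij) /=; ring.
    by case: (l == j) => /=; ring.
  have [->|li] := eqVneq l i; first by rewrite ?eqxx ?ji ?(negPf ij) /=; ring.
  by case: (l == j) => /=; ring.
move: x4J; rewrite x4E => /(memvZ (24%:R * in_basis P x i j)^-1).
by rewrite scalerA mulVf ?scale1r // mulf_neq0 // pnatr_eq0.
Qed.

(** Brackets with [E k i] and [E j l] show that the positions of the matrix units in [J] are closed
    under moving up and to the right, so they form a staircase. *)
Lemma ad_nilpotent_ideal_staircase (J : {vspace A}) : ad_nilpotent_ideal b J ->
  exists2 f : {ffun 'I_n.+1 -> 'I_n.+2}, frontier f & J = staircase (ext f).
Proof.
move=> [/andP[Jb bJ] Jnil]; pose S i j := E i j \in J.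
have Jup x : x \in J -> forall i j, (j <= i)%N -> in_basis P x i j = 0.
  by move=> xJ; apply: ad_nilpotent_strictly_upper (subvP Jb _ xJ) (Jnil _ xJ).
have Slt i j : S i j -> (i < j)%N.
  move=> Sij; rewrite ltnNge; apply/negP=> /(Jup _ Sij)/eqP.
  by rewrite in_basis_unit_elt // mxE !eqxx oner_eq0.
have Sl k i j : (k <= i)%N -> S i j -> S k j.
  rewrite leq_eqVlt => /predU1P[/val_inj->//|ki] Sij; have ij := Slt _ _ Sij.
  have := liebrvP _ _ _ bJ _ _ (unit_elt_borel ki) Sij.
  rewrite -adE ad_unit_elt // eqxx scale1r -val_eqE /= gtn_eqF ?scale0r ?subr0 //.
  exact: ltn_trans ij.
have Sr i j l : (j <= l)%N -> S i j -> S i l.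
  rewrite leq_eqVlt => /predU1P[/val_inj->//|jl] Sij; have ij := Slt _ _ Sij.
  have := liebrvP _ _ _ bJ _ _ (unit_elt_borel jl) Sij.
  rewrite -adE ad_unit_elt // eqxx scale1r -val_eqE /= gtn_eqF ?(ltn_trans ij) //.
  by rewrite scale0r sub0r memvN.
(* The bound [n.+1] holds vacuously and is the value for a row without units in [J]. *)
have ex i : exists m, [forall j : 'I_n.+1, (m <= j)%N ==> S i j].
  by exists n.+1; apply/forallP=> j; rewrite leqNgt ltn_ord.
pose g i := ex_minn (ex i).
have gN i : (g i <= n.+1)%N.
  rewrite /g; case: ex_minnP => m _; apply.
  by apply/forallP=> j; rewrite leqNgt ltn_ord.
have gS i j : S i j = (g i <= j)%N.
  rewrite /g; case: ex_minnP => m /forallP mS m_min; apply/idP/idP => [Sij|mj].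
    by apply: m_min; apply/forallP=> l; apply/implyP=> /Sr; apply.
  exact: (implyP (mS j)).
pose f := [ffun i => inord (g i) : 'I_n.+2].
have fE i : f i = g i :> nat by rewrite ffunE inordK // ltnS.
exists f.
  apply/andP; split; apply/forallP=> i.
    by rewrite fE ltnNge -gS; apply/negP=> /Slt; rewrite ltnn.
  apply/forallP=> j; apply/implyP=> ij; rewrite !fE leqNgt; apply/negP=> gji.
  have jN : (g j < n.+1)%N by apply: leq_trans gji (gN i).
  by have := gji; rewrite ltnNge -(gS i (Ordinal jN)) (Sl _ j) // gS.
(* By [unit_elt_component] every nonzero entry of a member of [J] puts its matrix unit in [J], so
   these units span [J]. *)
apply/vspaceP=> x; apply/idP/staircaseP => [xJ i j|x0].
  rewrite ext_ord fE ltnNge -gS => nS; apply/eqP; apply: contraNT nS => xij.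
  apply: (unit_elt_component _ bJ xJ xij); apply: contraNneq xij => ->.
  by rewrite Jup.
rewrite (unit_elt_sum uP x) memv_suml // => i _; rewrite memv_suml // => j _.
have [Sij|nS] := boolP (S i j); first exact: memvZ.
by rewrite x0 ?scale0r ?mem0v // ext_ord fE ltnNge -gS.
Qed.

End Ideals.
End Staircase.

(** * Counting the ideals *)

Local Open Scope classical_set_scope.
Local Open Scope card_scope.

Lemma card_ad_nilpotent_ideals (K : numClosedFieldType) (n : nat) (P : 'M[K]_n.+1)
    (b : {vspace 'M[K]_n.+1}) (k : nat) :
  P \is a GRing.unit ->
  (forall x, x \in b <->
     \tr x = 0 /\ forall i j : 'I_n.+1, (j < i)%N -> in_basis P x i j = 0) ->
  [set J : {vspace 'M[K]_n.+1} | ad_nilpotent_ideal b J /\ class_at_most J k]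
    #= `I_#|[set f : {ffun 'I_n.+1 -> 'I_n.+2} |
             frontier f & iter k.+1 (ext f) 0 == n.+1]%SET|.
Proof.
move=> uP bP; set S := [set f | _ & _]%SET.
rewrite (card_eqr card_II).
pose F (i : 'I_#|S|) := staircase P (ext (enum_val i)).
rewrite (_ : [set J | _] = F @` [set: 'I_#|S|]).
  by apply: inj_card_eq => i j _ _ /(staircase_inj uP) /enum_val_inj.
apply/seteqP; split=> [J [/(ad_nilpotent_ideal_staircase uP bP)[f fF ->]]|_ [i _ <-]].
  move=> /class_at_mostP/(lpow_staircase_eq0 uP k fF) fk.
  have fS : f \in S by rewrite inE fF fk eqxx.
  by exists (enum_rank_in fS f); rewrite // /F enum_rankK_in.
have := enum_valP i; rewrite inE => /andP[fF /eqP fk].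
split; last exact/class_at_mostP/(lpow_staircase_eq0 uP k fF).
by have /frontierP[f1 fM] := fF; apply: staircase_ideal => // j; apply: f1.
Qed.

(* C = R[i], for R any model of the real numbers; sl K n is sl(n+1, K). *)
Theorem corollary4p7 (R : realType) (n : nat) (hn : (1 <= n)%N)
    (h : {vspace 'M[R[i]]_n.+1}) (hh : cartan_subalgebra (sl R[i] n) h)
    (Dp : seq (dual h)) (hDp : positive_roots (sl R[i] n) Dp) :
  let b := borel (sl R[i] n) Dp in
  [set i : {vspace 'M[R[i]]_n.+1} | ad_nilpotent_ideal b i /\ class_at_most i 2]
    #= `I_(fib (2 * n)) /\
  [set i : {vspace 'M[R[i]]_n.+1} | ad_nilpotent_ideal b i /\ class_at_most i 3]
    #= `I_((3 ^ n + 1) %/ 2).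
Proof.
move=> b; have [P uP bP] := borel_upper_triangular hh hDp.
(* Class at most [k] means that the iterate of order [k.+1] reaches [n.+1], and [card_frontier]
   shifts the index once more: class 2 leads to [forest_gf] at 4, class 3 to [forest_gf] at 5. *)
have card2 := card_frontier n.+1 3; rewrite forest_gf_fib in card2.
have card3 := card_frontier n.+1 4; rewrite forest_gf_pow3 in card3.
case: card2 => <-; case: card3 => <-.
by split; apply: card_ad_nilpotent_ideals uP bP.
Qed.
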